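(* The class of $l^3$-convex geometries is not hereditary for induced subgraphs: there exist a finite, undirected, simple, connected graph $G$ that is an $l^3$-convex geometry and a connected induced subgraph $G'$ of $G$ that is not an $l^3$-convex geometry.
   Context: An induced path in a graph $G$ is a path $x_0,\ldots,x_p$ of distinct vertices in which $x_i$ and $x_j$ are adjacent if and only if $|i-j|=1$; its length is $p$, the number of its edges. A set $S\subseteq V(G)$ is $l^3$-convex if for every pair of vertices $x,y\in S$, every induced path of $G$ of length at most $3$ connecting $x$ and $y$ has all its vertices in $S$. The $l^3$-convex hull $\mathit{hull}_{l^3}(S)$ of $S\subseteq V(G)$ is the smallest $l^3$-convex set containing $S$, i.e. the intersection of all $l^3$-convex sets of $G$ containing $S$. A vertex $x$ of an $l^3$-convex set $S$ is an extreme point of $S$ if $S\setminus\{x\}$ is also $l^3$-convex; $\mathit{Ext}_{l^3}(S)$ denotes the set of all extreme points of $S$. The graph $G$ is an $l^3$-convex geometry if $\mathit{hull}_{l^3}(\mathit{Ext}_{l^3}(S))=S$ for every $l^3$-convex set $S$ of $G$. For the induced subgraph $G'$, all these notions are taken with respect to $G'$ itself. *)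

(* Defs.v *)
From HB Require Import structures.
From mathcomp Require Import all_boot.

Set Implicit Arguments.
Unset Strict Implicit.
Unset Printing Implicit Defensive.

Record sgraph := SGraph {
  vertex :> finType;
  adj : rel vertex;
  adj_sym : symmetric adj;
  adj_irr : irreflexive adj }.

Arguments adj {G} : rename.

Definition connected (G : sgraph) : bool :=
  [forall x : G, forall y : G, connect adj x y].

Section InducedSubgraph.
Variables (G : sgraph) (A : {set G}).

Definition induced_adj : rel {x : G | x \in A} :=
  fun x y => adj (val x) (val y).

Lemma induced_adj_sym : symmetric induced_adj.
Proof. by move=> x y; apply: adj_sym. Qed.

Lemma induced_adj_irr : irreflexive induced_adj.
Proof. by move=> x; apply: adj_irr. Qed.

Definition induced : sgraph := SGraph induced_adj_sym induced_adj_irr.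

End InducedSubgraph.

Section Convexity.
Variable G : sgraph.

(* A path of length p is a family of p + 1 vertices x_0, ..., x_p. *)
Definition induced_path p (x : p.+1.-tuple G) : bool :=
  uniq x &&
  [forall i : 'I_p.+1, forall j : 'I_p.+1,
     adj (tnth x i) (tnth x j) == ((j == i.+1 :> nat) || (i == j.+1 :> nat))].

Definition l3_convex (S : {set G}) : bool :=
  [forall p : 'I_4, forall x : p.+1.-tuple G,
     [&& induced_path x, tnth x ord0 \in S & tnth x ord_max \in S] ==>
     [forall i, tnth x i \in S]].

Definition l3_hull (S : {set G}) : {set G} :=
  \bigcap_(C : {set G} | l3_convex C && (S \subset C)) C.

Definition l3_ext (S : {set G}) : {set G} :=
  [set x in S | l3_convex (S :\ x)].

Definition l3_convex_geometry : Prop :=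
  forall S : {set G}, l3_convex S -> l3_hull (l3_ext S) = S.

End Convexity.

Arguments l3_convex_geometry : clear implicits.

(* Main.v *)
Require Import Defs.
From mathcomp Require Import all_boot.

(** The witness [gadget] is the path 0 - 1 - 2 - 3 - 4 together with a vertex 5
    adjacent to 1, 2, 3 and 4 but not to 0; the induced subgraph is the path
    itself.

    In the path, the only vertices that are not interior to a short induced
    path are 0 and 4. These two are at distance 4, too far apart for any
    induced path of length at most 3 to join them, so they already form an
    [l^3]-convex set and do not generate the whole path.

    In the gadget, the vertex 5 provides the induced path 0 - 1 - 5 - 4, and
    from 1 and 4 the induced path 1 - 2 - 3 - 4 recovers the rest: 0 and 4
    generate everything. It matters that 5 is not adjacent to 0, since
    otherwise 0 - 5 - 4 would be the only short induced path from 0 to 4.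

    For an arbitrary nonempty convex set [S] of the gadget other than {5},
    note that a vertex whose neighbours in [S] are pairwise adjacent is
    extreme, because an interior vertex of an induced path has two
    non-adjacent neighbours. Let [a] and [b] be the smallest and the largest
    path vertex of [S]. Apart from S = {0, 1, 5}, where the extreme points 0
    and 5 generate 1, both [a] and [b] are extreme: their neighbours in [S]
    are at most one further path vertex and 5, which are then adjacent.
    They generate all path vertices of [S]. Finally 5, if it belongs to [S], is generated by [a] and [b] when
    they are at least 2 apart and distinct from the pair 0, 2; otherwise its
    neighbours in [S] are pairwise adjacent and 5 is extreme.

    Formally, convexity in the gadget is reduced to seven closure rules
    ([gadget_convexE]), after which the claim on extreme points concerns the
    finitely many subsets of a six-element set and is settled by cases
    ([rules_extreme]). *)

Set Implicit Arguments.
Unset Strict Implicit.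
Unset Printing Implicit Defensive.

(** * Convexity through explicit induced paths *)

(** Paths of length 0 and 1 impose nothing. On three edges the listed
    adjacencies and non-adjacencies already force the four vertices to be
    distinct, whereas on two edges the ends might coincide. *)
Lemma l3_convexP (G : sgraph) (S : {set G}) :
  reflect
    ((forall x y z, x != z -> adj x y -> adj y z -> ~~ adj x z ->
        x \in S -> z \in S -> y \in S) /\
     (forall x y z w, adj x y -> adj y z -> adj z w ->
        ~~ adj x z -> ~~ adj y w -> ~~ adj x w ->
        x \in S -> w \in S -> (y \in S) && (z \in S)))
    (l3_convex S).
Proof.
have irr := @adj_irr G; have sym := @adj_sym G.
have neq (x y : G) : adj x y -> x != y.
  by apply: contraTneq => ->; rewrite irr.
apply: (iffP forallP) => [conv | [conv2 conv3] [p lt_p4]].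
- split=> [x y z xz xy yz /negbTE Nxz xS zS
          | x y z w xy yz zw /negbTE Nxz /negbTE Nyw /negbTE Nxw xS wS].
    have /forallP/(_ [tuple x; y; z])/implyP H := conv (Ordinal (isT : 2 < 4)).
    have /H/forallP/(_ (Ordinal (isT : 1 < 3))) :
      [&& induced_path [tuple x; y; z],
          tnth [tuple x; y; z] ord0 \in S &
          tnth [tuple x; y; z] ord_max \in S].
      rewrite xS zS !andbT; apply/andP; split.
        by rewrite /= !inE negb_or (neq _ _ xy) xz (neq _ _ yz).
      apply/forallP=> -[[|[|[|//]]] ?]; apply/forallP=> -[[|[|[|//]]] ?];
        by rewrite !(tnth_nth x) /= ?irr ?xy ?yz ?Nxz // sym ?xy ?yz ?Nxz.
    by rewrite (tnth_nth x).
  have /forallP/(_ [tuple x; y; z; w])/implyP H := conv (Ordinal (isT : 3 < 4)).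
  have /H/forallP inS :
      [&& induced_path [tuple x; y; z; w],
          tnth [tuple x; y; z; w] ord0 \in S &
          tnth [tuple x; y; z; w] ord_max \in S].
    rewrite xS wS !andbT; apply/andP; split.
      rewrite /= !inE !negb_or (neq _ _ xy) (neq _ _ yz) (neq _ _ zw) /= !andbT.
      rewrite -?andbA; apply/and3P; split; apply/eqP => e; subst.
      + by rewrite zw in Nxw.
      + by rewrite sym xy in Nyw.
      + by rewrite xy in Nxw.
    apply/forallP=> -[[|[|[|[|//]]]] ?]; apply/forallP=> -[[|[|[|[|//]]]] ?];
      by rewrite !(tnth_nth x) /= ?irr ?xy ?yz ?zw ?Nxz ?Nyw ?Nxw //
                 sym ?xy ?yz ?zw ?Nxz ?Nyw ?Nxw.
  have := inS (Ordinal (isT : 1 < 4)); have := inS (Ordinal (isT : 2 < 4)).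
  by rewrite !(tnth_nth x) /= => -> ->.
apply/forallP => t; apply/implyP => /and3P[/andP[uniq_t /forallP adj_t] t0 tp].
(* Numeric indices, through [inord], survive the case analysis on [p]. *)
have {}adj_t i j (lti : i < p.+1) (ltj : j < p.+1) :
    adj (tnth t (Ordinal lti)) (tnth t (Ordinal ltj)) = (j == i.+1) || (i == j.+1).
  by have /forallP/(_ (Ordinal ltj))/eqP := adj_t (Ordinal lti).
have ordE i (lti : i < p.+1) : Ordinal lti = inord i by apply/val_inj; rewrite /= inordK.
have {}adj_t i j : i < p.+1 -> j < p.+1 ->
    adj (tnth t (inord i)) (tnth t (inord j)) = (j == i.+1) || (i == j.+1).
  by move=> lti ltj; rewrite -(ordE _ lti) -(ordE _ ltj) adj_t.
have e0 : ord0 = inord 0 :> 'I_p.+1 by apply/val_inj; rewrite /= inordK.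
have ep : ord_max = inord p :> 'I_p.+1 by apply/val_inj; rewrite /= inordK.
rewrite e0 in t0; rewrite ep in tp.
apply/forallP => i; rewrite -(inord_val i).
case: i => i /= lti.
case: p lt_p4 t uniq_t t0 tp adj_t {ordE e0 ep} lti => [|[|[|[|//]]]] lt_p4 t uniq_t t0 tp adj_t.
- by case: i.
- by case: i => [|[]].
- case: i => [|[|[|//]]] // _.
  apply: (conv2 _ _ _ _ _ _ _ t0 tp); rewrite ?adj_t //.
  by rewrite (inj_eq (tuple_uniqP _ uniq_t)) // -val_eqE /= !inordK.
- have /andP[y z] : (tnth t (inord 1) \in S) && (tnth t (inord 2) \in S).
    by apply: (conv3 _ _ _ _ _ _ _ _ _ _ t0 tp); rewrite ?adj_t.
  by case: i => [|[|[|[|//]]]].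
Qed.

(** Descending along the rank leads every vertex to the root [r]. *)
Lemma connected_rank (G : sgraph) (r : G) (rank : G -> nat) :
  (forall x, x != r -> exists2 y, adj x y & rank y < rank x) -> connected G.
Proof.
move=> descend.
have sym : connect_sym (@adj G) by apply: sym_connect_sym; apply: adj_sym.
suff to_r n x : rank x < n -> connect adj x r.
  apply/forallP=> x; apply/forallP=> y.
  apply: (connect_trans (to_r _ x (ltnSn _))).
  by rewrite sym (to_r _ y (ltnSn _)).
elim: n x => // n IHn x lt_x; have [-> // | /descend[y xy lt_yx]] := eqVneq x r.
by apply: (connect_trans (connect1 xy)); apply: IHn; apply: leq_trans lt_yx _.
Qed.

(** Unfolding the hull as an intersection avoids computing it: a convex set is
    generated by its extreme points as soon as every convex set that contains
    the extreme points contains the whole set. *)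
Lemma l3_convex_geometryP (G : sgraph) :
  l3_convex_geometry G <->
  (forall S C : {set G}, l3_convex S -> l3_convex C ->
     l3_ext S \subset C -> S \subset C).
Proof.
split=> [geom S C convS convC extC | gen S convS].
  by rewrite -(geom S convS); apply: bigcap_inf; rewrite convC.
apply/eqP; rewrite eqEsubset; apply/andP; split.
  apply: bigcap_inf; rewrite convS; apply/subsetP=> x.
  by rewrite inE => /andP[].
by apply/bigcapsP=> C /andP[convC]; apply: gen.
Qed.

(** * The gadget *)

Definition gadget_arc (i j : nat) := if j == 5 then 0 < i < 5 else j == i.+1.

Definition gadget_adj : rel 'I_6 := fun i j => gadget_arc i j || gadget_arc j i.

Lemma gadget_adj_sym : symmetric gadget_adj.
Proof. by move=> i j; rewrite /gadget_adj orbC. Qed.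

Lemma gadget_adj_irr : irreflexive gadget_adj.
Proof. by case=> [[|[|[|[|[|[|//]]]]]] ?]. Qed.

Definition gadget := SGraph gadget_adj_sym gadget_adj_irr.

Lemma gadget_connected : connected gadget.
Proof.
apply: (@connected_rank gadget ord0 (@nat_of_ord 6)).
by case=> [[|[|[|[|[|[|//]]]]]] ?] // _;
  [exists (inord 0) | exists (inord 1) | exists (inord 2) | exists (inord 3)
   | exists (inord 1)]; rewrite /= /gadget_adj ?inordK.
Qed.

(** A triple [(i, j, m)] records that [m] lists the interior vertices of all
    induced paths of length 2 or 3 from [i] to [j]. For instance 1 and 4 are
    joined by 1 - 5 - 4 and by 1 - 2 - 3 - 4, but 0 and 4 only by
    0 - 1 - 5 - 4. *)
Definition intervals : seq (nat * nat * seq nat) :=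
  [:: (0, 2, [:: 1]); (0, 5, [:: 1]); (0, 3, [:: 1; 2; 5]); (0, 4, [:: 1; 5]);
      (1, 3, [:: 2; 5]); (1, 4, [:: 2; 3; 5]); (2, 4, [:: 3; 5])].

Definition rules (s : pred nat) : bool :=
  all (fun t => s t.1.1 && s t.1.2 ==> all s t.2) intervals.

Lemma gadget_convexE (S : {set gadget}) :
  l3_convex S = rules (fun i => (inord i : 'I_6) \in S).
Proof.
set s : pred nat := fun i => _; have in_s (x : gadget) : (x \in S) = s x.
  by rewrite /s inord_val.
apply/l3_convexP/idP => [[conv2 conv3] | rulesS].
  have P2 i j k : i < 6 -> j < 6 -> k < 6 -> i != k ->
      gadget_arc i j || gadget_arc j i -> gadget_arc j k || gadget_arc k j ->
      ~~ (gadget_arc i k || gadget_arc k i) -> s i -> s k -> s j.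
    move=> li lj lk ik ij jk nik; apply: conv2;
      by rewrite /= /gadget_adj -?val_eqE /= ?inordK.
  have P3 i j k l : i < 6 -> j < 6 -> k < 6 -> l < 6 ->
      gadget_arc i j || gadget_arc j i -> gadget_arc j k || gadget_arc k j ->
      gadget_arc k l || gadget_arc l k -> ~~ (gadget_arc i k || gadget_arc k i) ->
      ~~ (gadget_arc j l || gadget_arc l j) ->
      ~~ (gadget_arc i l || gadget_arc l i) -> s i -> s l -> s j && s k.
    move=> li lj lk ll ij jk kl nik njl nil; apply: conv3;
      by rewrite /= /gadget_adj ?inordK.
  rewrite /rules /= !andbT.
  do ![apply/andP; split]; apply/implyP=> /andP[si sj].
  - by apply: (P2 0 1 2).
  - by apply: (P2 0 1 5).
  - have /andP[-> ->] := P3 0 1 2 3 isT isT isT isT isT isT isT isT isT isT si sj.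
    by have /andP[] := P3 0 1 5 3 isT isT isT isT isT isT isT isT isT isT si sj.
  - exact: (P3 0 1 5 4).
  - by rewrite (P2 1 2 3) // (P2 1 5 3).
  - have /andP[-> ->] := P3 1 2 3 4 isT isT isT isT isT isT isT isT isT isT si sj.
    exact: (P2 1 5 4).
  - by rewrite (P2 2 3 4) // (P2 2 5 4).
split=> [x y z | x y z w]; rewrite !in_s; move: rulesS => {in_s};
  rewrite /rules /= /gadget_adj; move: (s) => {}s.
  by case: x y z => [[|[|[|[|[|[|//]]]]]] ?] [[|[|[|[|[|[|//]]]]]] ?]
       [[|[|[|[|[|[|//]]]]]] ?] //=;
     case: (s 0); case: (s 1); case: (s 2); case: (s 3); case: (s 4); case: (s 5).
by case: x y z w => [[|[|[|[|[|[|//]]]]]] ?] [[|[|[|[|[|[|//]]]]]] ?] //=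
     [[|[|[|[|[|[|//]]]]]] ?] //= [[|[|[|[|[|[|//]]]]]] ?] //=;
   case: (s 0); case: (s 1); case: (s 2); case: (s 3); case: (s 4); case: (s 5).
Qed.

(** The combinatorial content of the gadget being a convex geometry: [s] and
    [c] stand for convex sets, and the last hypothesis says that [c] contains
    the extreme points of [s]. *)
Lemma rules_extreme (s c : pred nat) :
  rules s -> rules c ->
  (forall k, k < 6 -> s k -> rules (fun i => (i != k) && s i) -> c k) ->
  forall k, k < 6 -> s k -> c k.
Proof.
move=> rs rc ext.
have := (ext 0 isT, ext 1 isT, ext 2 isT, ext 3 isT, ext 4 isT, ext 5 isT).
move=> {ext} [[[[[e0 e1] e2] e3] e4] e5].
suff: [&& s 0 ==> c 0, s 1 ==> c 1, s 2 ==> c 2, s 3 ==> c 3, s 4 ==> c 4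
        & s 5 ==> c 5].
  case/and5P=> i0 i1 i2 i3 /andP[i4 i5].
  by case=> [|[|[|[|[|[|//]]]]]] _; apply/implyP.
move: rs rc e0 e1 e2 e3 e4 e5; rewrite /rules /=.
case: (s 0); case: (s 1); case: (s 2); case: (s 3); case: (s 4); case: (s 5) => //= _;
case: (c 0) => //=; case: (c 1) => //=; case: (c 2) => //=; case: (c 3) => //=;
case: (c 4) => //=; case: (c 5) => //= *; firstorder.
Qed.

Lemma gadget_convex_geometry : l3_convex_geometry gadget.
Proof.
apply/l3_convex_geometryP => S C; rewrite !gadget_convexE => rS rC /subsetP extC.
apply/subsetP=> x; rewrite -(inord_val x).
apply: (rules_extreme rS rC _ (ltn_ord x)) => k ltk kS rk.
apply: extC; rewrite inE kS gadget_convexE /=.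
apply: etrans rk; apply: eq_in_all => -[[i j] m] t_int /=.
(* [rules] only inspects numbers below 6, where [inord] is faithful. *)
have ne n : n < 6 -> (inord n \in S :\ (inord k : gadget)) = (n != k) && (inord n \in S).
  by move=> ltn; rewrite !inE -val_eqE /= !inordK.
have /allP/(_ _ t_int)/and3P[/= lti ltj ltm] :
  all (fun t => [&& t.1.1 < 6, t.1.2 < 6 & all (gtn 6) t.2]) intervals by [].
by rewrite !ne //; congr (_ ==> _); apply: eq_in_all => n /(allP ltm)/ne.
Qed.

(** * The induced path *)

Definition spine : {set gadget} := [set x : 'I_6 | x < 5].

Lemma spine_vertex k : k < 5 -> exists x : induced spine, val (val x) = k.
Proof.
move=> ltk; have ink : (inord k : gadget) \in spine by rewrite inE inordK ?ltk // leqW.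
by exists (@exist gadget (fun x => x \in spine) _ ink); rewrite /= inordK // leqW.
Qed.

Lemma spine_eqE (x y : induced spine) : (x == y) = (val (val x) == val (val y)).
Proof. by rewrite !val_eqE. Qed.

Lemma spine_adjE (x y : induced spine) :
  adj x y = (val (val y) == (val (val x)).+1) || (val (val x) == (val (val y)).+1).
Proof.
case: x y => [x xA] [y yA]; rewrite /= /induced_adj /= /gadget_adj.
by move: xA yA; rewrite !inE /gadget_arc => /ltn_eqF-> /ltn_eqF->.
Qed.

Lemma spine_connected : connected (induced spine).
Proof.
have [r r0] := spine_vertex (isT : 0 < 5).
apply: (@connected_rank _ r (fun x => val (val x))) => x.
rewrite spine_eqE r0 -lt0n => x_gt0.
have x_lt5 : val (val x) < 5 by have := valP x; rewrite inE.
have [|y yx] := @spine_vertex (val (val x)).-1.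
  exact: leq_ltn_trans (leq_pred _) x_lt5.
by exists y; rewrite ?spine_adjE yx prednK // eqxx orbT.
Qed.

Definition spine_ends : {set induced spine} :=
  [set x | (val (val x) == 0) || (val (val x) == 4)].

(** The ends are at distance 4, so no short induced path joins them. *)
Lemma spine_ends_convex : l3_convex spine_ends.
Proof.
apply/l3_convexP; split=> [x y z | x y z w]; rewrite !inE !spine_adjE.
  rewrite spine_eqE.
  move: (val (val x)) (val (val y)) (val (val z)) => {}x {}y {}z.
  move=> xz + + _ /orP[] /eqP ex /orP[] /eqP ez; move: xz; rewrite ex ez //=.
    by case: y => [|[|[|[|[|[|y]]]]]].
  by case: y => [|[|[|[|[|[|y]]]]]].
move: (val (val x)) (val (val y)) (val (val z)) (val (val w)) => {}x {}y {}z {}w.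
move=> xy + zw _ _ _ /orP[] /eqP ex /orP[] /eqP ew; move: xy zw; rewrite ex ew;
  by case: y => [|[|[|[|[|[|y]]]]]]; case: z => [|[|[|[|[|[|z]]]]]].
Qed.

(** Each of 1, 2, 3 is the middle of the induced path formed with its two
    neighbours. *)
Lemma spine_ext : l3_ext [set: induced spine] \subset spine_ends.
Proof.
apply/subsetP=> y; rewrite !inE => /l3_convexP[conv2 _].
have y_lt5 : val (val y) < 5 by have := valP y; rewrite inE.
apply: contraT; rewrite negb_or => /andP[y_neq0 y_neq4].
have [k yE] : exists k, val (val y) = k.+1.
  by case: (val (val y)) y_neq0 => // k; exists k.
rewrite yE in y_lt5 y_neq4.
have [x xE] := @spine_vertex k (ltnW y_lt5).
have [|z zE] := @spine_vertex k.+2; first by rewrite ltn_neqAle y_neq4.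
have := conv2 x y z.
rewrite !inE !spine_adjE !spine_eqE xE yE zE.
by rewrite !eqxx ?orbT; apply; elim: (k).
Qed.

Lemma spine_not_convex_geometry : ~ l3_convex_geometry (induced spine).
Proof.
move/l3_convex_geometryP=> /(_ setT spine_ends) gen.
have [x x1] := spine_vertex (isT : 1 < 5).
have convT : l3_convex [set: induced spine].
  by apply/l3_convexP; split=> *; rewrite !inE.
have /subsetP/(_ x) := gen convT spine_ends_convex spine_ext.
by rewrite !inE x1 => /(_ isT).
Qed.

(** * Non-heredity *)

Theorem mainTheorem3 :
  exists G : sgraph,
    [/\ connected G, l3_convex_geometry G &
        exists A : {set G},
          connected (induced A) /\ ~ l3_convex_geometry (induced A)].
Proof.
exists gadget; split; [exact: gadget_connected | exact: gadget_convex_geometry |].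
by exists spine; split; [exact: spine_connected | exact: spine_not_convex_geometry].
Qed.
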